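(* Let $S^A=(S^i)_{i\in A}$ be a locally bounded vector semimartingale on $[0,T]$ on a probability space $(\Omega,\mathcal F,\mathbb P)$, let $\mathbb F^{S^A}$ be its natural filtration, and let $\mathbb F^{S^A}\subseteq\mathbb H$ be filtrations under the usual conditions (the inclusion meaning $\mathcal F^{S^A}_t\subseteq\mathcal H_t$ for all $t\in[0,T]$). If $S^A$ is a $(\mathbb Q,\mathbb H)$-local martingale for a probability measure $\mathbb Q\sim\mathbb P$, then $S^A$ is a $(\mathbb Q,\mathbb F^{S^A})$-local martingale.
   Context: All processes and filtrations are indexed by a finite horizon $[0,T]$. The filtrations $\mathbb F^{S^A}$ (the natural price filtration, i.e. the one generated by $S^A$, taken under the usual conditions) and $\mathbb H=(\mathcal H_t)_{0\le t\le T}$ satisfy the usual conditions; equalities of $\sigma$-fields are up to $\mathbb P$-null sets. $S^A$ represents a group of discounted asset prices. The local martingale property of a vector process is understood componentwise: $S^A$ is a $(\mathbb Q,\mathbb K)$-local martingale if each coordinate $S^i$ is a local martingale in the filtration $\mathbb K$ under $\mathbb Q$. $\mathbb Q\sim\mathbb P$ means that the two measures are equivalent. *)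

(* Defs.v *)
From HB Require Import structures.
From mathcomp Require Import all_boot all_order all_algebra.
From mathcomp Require Import all_classical all_reals all_analysis.
Set Implicit Arguments.
Unset Strict Implicit.
Unset Printing Implicit Defensive.
Import Order.TTheory GRing.Theory Num.Theory.
Import numFieldNormedType.Exports.
Local Open Scope classical_set_scope.
Local Open Scope ring_scope.

(* Processes and filtrations are functions of a time in R, of which only the
   values at times in [0, T] are ever used. *)

Section filtrations.
Context {R : realType} {d : measure_display} {Omega : measurableType d}.
Variables (P : probability Omega R) (T : R).
Implicit Types (F G : R -> set_system Omega) (X : R -> Omega -> R).

Record filtration F : Prop := Filtration {
  filtration_sigma_algebra :
    forall t : R, 0 <= t <= T -> sigma_algebra setT (F t) ;
  filtration_measurable :
    forall t : R, 0 <= t <= T -> F t `<=` measurable ;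
  filtration_mono :
    forall s t : R, 0 <= s -> s <= t -> t <= T -> F s `<=` F t }.

(* [P.-negligible N] only requires N to be included in an event of probability
   zero: together with [filtration_measurable], the second clause forces
   (Omega, P) to be complete. *)
Record usual_conditions F : Prop := UsualConditions {
  usual_filtration : filtration F ;
  usual_complete : forall N, P.-negligible N -> F 0 N ;
  usual_right_continuous : forall t : R, 0 <= t < T ->
    \bigcap_(u in [set u | t < u <= T]) F u `<=` F t }.

(* The usual augmentation of the filtration generated by all the coordinates of
   S. Capping times at T makes the formula give sigma(S_r, r <= T) together
   with the null sets at t = T. *)
Definition natural_filtration (A : finType) (S : A -> R -> Omega -> R)
    : R -> set_system Omega := fun t =>
  \bigcap_(u in [set u | t < u])
    <<s [set E | exists i (r : R) (B : set R),
           [/\ 0 <= r <= Num.min u T, measurable B & E = S i r @^-1` B]]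
        `|` P.-negligible >>.

Definition sub_filtration F G := forall t : R, 0 <= t <= T -> F t `<=` G t.

Definition sub_measurable_fun (G : set_system Omega) (Y : Omega -> R) :=
  forall B : set R, measurable B -> G (Y @^-1` B).

Definition adapted F X :=
  forall t : R, 0 <= t <= T -> sub_measurable_fun (F t) (X t).

Definition cadlag_path (x : R -> R) :=
  (forall t : R, 0 <= t < T -> x @ t^'+ --> x t) /\
  (forall t : R, 0 < t <= T -> cvg (x @ t^'-)).

Definition cadlag X := {ae P, forall w, cadlag_path (X ^~ w)}.

Definition stopping_time F (tau : Omega -> R) :=
  (forall w, 0 <= tau w <= T) /\
  (forall t : R, 0 <= t <= T -> F t [set w | tau w <= t]).

Definition localizing_sequence F (tau : nat -> Omega -> R) :=
  [/\ forall n, stopping_time F (tau n),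
      forall w, nondecreasing_seq (tau ^~ w) &
      {ae P, forall w, exists n, tau n w = T}].

(* X^tau 1_{tau > 0}: the indicator makes localization insensitive to the
   integrability or boundedness of X_0. *)
Definition stopped (tau : Omega -> R) X : R -> Omega -> R :=
  fun t w => if 0 < tau w then X (Num.min t (tau w)) w else 0.

Definition is_conditional_expectation (G : set_system Omega)
    (X Y : Omega -> R) :=
  [/\ sub_measurable_fun G Y,
      P.-integrable setT (EFin \o Y) &
      forall E, G E ->
        (\int[P]_(w in E) (Y w)%:E = \int[P]_(w in E) (X w)%:E)%E].

Definition martingale F X :=
  [/\ adapted F X,
      forall t : R, 0 <= t <= T -> P.-integrable setT (EFin \o X t) &
      forall s t : R, 0 <= s -> s <= t -> t <= T ->
        is_conditional_expectation (F s) (X t) (X s)].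

Definition local_martingale F X :=
  [/\ adapted F X, cadlag X &
      exists2 tau, localizing_sequence F tau &
        forall n, martingale F (stopped (tau n) X)].

Definition finite_variation_process F X :=
  [/\ adapted F X, cadlag X &
      {ae P, forall w, bounded_variation 0 T (X ^~ w)}].

Definition semimartingale F X :=
  [/\ adapted F X, cadlag X &
      exists M V, [/\ local_martingale F M, finite_variation_process F V,
        {ae P, forall w, M 0 w = 0 /\ V 0 w = 0} &
        {ae P, forall w, forall t : R, 0 <= t <= T ->
          X t w = X 0 w + M t w + V t w}]].

Definition locally_bounded F (A : finType) (S : A -> R -> Omega -> R) :=
  exists2 tau, localizing_sequence F tau &
    forall n, exists C : R, {ae P, forall w, forall i (t : R), 0 <= t <= T ->
      `|stopped (tau n) (S i) t w| <= C}.

End filtrations.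

Definition equivalent_measures {R : realType} {d : measure_display}
    {Omega : measurableType d} (Q P : probability Omega R) :=
  Q `<< P /\ P `<< Q.

(* Main.v *)
(* Let tau localize S for its natural filtration F, with S bounded up to tau, and
   let sigma_m localize S^i under (Q, H).  Since tau is also an H-stopping time,
   optional stopping makes S^i stopped at the minimum of tau and sigma_m an
   H-martingale; it is bounded uniformly in m, so dominated convergence shows that
   S^i stopped at tau is an H-martingale.  This process is F-adapted, because F is
   complete and paths are right-continuous, and the defining identity of an
   H-martingale tested on events of F_s, which are events of H_s, says that it is
   an F-martingale.  The same tau therefore localizes S^i for F.

   Optional stopping and adaptedness both come from sampling the process at tau
   rounded up to a finite grid of ]s, t]. *)
Require Import Defs.
From mathcomp Require Import all_boot all_order all_algebra.
From mathcomp Require Import all_classical all_reals all_analysis.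
From mathcomp Require Import measurable_realfun lra.
Import Order.TTheory GRing.Theory Num.Theory.
Import numFieldNormedType.Exports.
Local Open Scope classical_set_scope.
Local Open Scope ring_scope.
Set Implicit Arguments.
Unset Strict Implicit.
Unset Printing Implicit Defensive.

(** * Rounding times up to a finite grid *)

Section round_up.
Context {R : realType}.
Implicit Types (s t x : R) (k i : nat).

Definition grid s t k i : R := s + (t - s) * (i%:R / k.+1%:R).

(** For x in ]s, t], the right end of the left-open cell that contains x, in closed form through the
    ceiling. Counting [k.+1] cells keeps the denominator nonzero at k = 0. *)
Definition round_up s t k x : R :=
  s + (t - s) * ((Num.ceil ((x - s) / (t - s) * k.+1%:R))%:~R / k.+1%:R).

Lemma grid_mono s t k : s < t -> {mono grid s t k : i j / (i < j)%N >-> i < j}.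
Proof.
move=> st i j; rewrite /grid ltrD2l ltr_pM2l ?subr_gt0// ltr_pM2r ?invr_gt0//.
by rewrite ltr_nat.
Qed.

Lemma grid0 s t k : grid s t k 0 = s.
Proof. by rewrite /grid mul0r mulr0 addr0. Qed.

Lemma grid_last s t k : grid s t k k.+1 = t.
Proof. by rewrite /grid divff// mulr1 addrC subrK. Qed.

Lemma grid_itv s t k i : s < t -> (i <= k.+1)%N -> s <= grid s t k i <= t.
Proof.
move=> st ik; rewrite -{1}(grid0 s t k) -[X in _ && (_ <= X)](grid_last s t k).
by rewrite !leNgt !grid_mono// -!leqNgt ik.
Qed.

Lemma grid_cell s t k x : s < x <= t ->
  exists2 i, (i < k.+1)%N & grid s t k i < x <= grid s t k i.+1.
Proof.
move=> /andP[sx]; rewrite -[X in _ <= X -> _](grid_last s t k).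
(* The induction runs over the index of the grid point that bounds x, while the mesh, fixed by [k],
   stays the same. *)
elim: k.+1 => [|m IH]; first by rewrite grid0 leNgt sx.
have [xm _|mx xm] := leP x (grid s t k m).
  by have [i im ?] := IH xm; exists i => //; rewrite ltnS ltnW.
by exists m => //; rewrite mx.
Qed.

Lemma round_up_cell s t k i x : s < t ->
  grid s t k i < x <= grid s t k i.+1 -> round_up s t k x = grid s t k i.+1.
Proof.
move=> st /andP[ix xi]; rewrite /round_up (@ceil_def _ _ i.+1)//.
have ts : 0 < t - s by rewrite subr_gt0.
have -> : (i.+1%:Z - 1)%:~R = i%:R :> R by rewrite -addn1 PoszD addrK.
apply/andP; split.
- rewrite -ltr_pdivrMr// ltr_pdivlMr// mulrC.
  by rewrite ltrBrDl.
- rewrite -ler_pdivlMr// ler_pdivrMr// [leRHS]mulrC.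
  by rewrite lerBlDl.
Qed.

Lemma grid_inj_cell s t k i j x : s < t ->
  grid s t k i < x <= grid s t k i.+1 -> grid s t k j < x <= grid s t k j.+1 ->
  i = j.
Proof.
move=> st /andP[i1 i2] /andP[j1 j2].
have : grid s t k i < grid s t k j.+1 by exact: lt_le_trans i1 j2.
have : grid s t k j < grid s t k i.+1 by exact: lt_le_trans j1 i2.
by rewrite !grid_mono// !ltnS => ? ?; apply/eqP; rewrite eqn_leq; apply/andP.
Qed.

Lemma round_up_itv s t k x : s < x <= t -> x <= round_up s t k x <= t.
Proof.
move=> sxt; have st : s < t by case/andP: sxt; exact: lt_le_trans.
have [i ik ix] := grid_cell k sxt.
rewrite (round_up_cell st ix); case/andP: ix => _ -> /=.
by have /andP[] := grid_itv st ik.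
Qed.

(** A cell has length (t - s) / (k + 1), so the rounded time is squeezed between x and x plus this
    length. *)
Lemma cvg_round_up s t x : s < x <= t -> round_up s t k x @[k --> \oo] --> x.
Proof.
move=> sxt; have st : s < t by case/andP: sxt; exact: lt_le_trans.
have lim : x + (t - s) * harmonic k @[k --> \oo] --> x.
  rewrite -[X in _ --> X]addr0 -(mulr0 (t - s)).
  by apply: cvgD; [exact: cvg_cst|apply: cvgMr; exact: cvg_harmonic].
apply: (squeeze_cvgr _ (cvg_cst x) lim); apply: nearW => k.
have [i ik ix] := grid_cell k sxt.
have /andP[-> _] := round_up_itv k sxt.
rewrite (round_up_cell st ix) /=; case/andP: ix => ix _.
by rewrite /grid /harmonic -[i.+1%:R]natr1 [(_ + 1) / _]mulrDl div1r mulrDr addrA lerD2r ltW.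
Qed.

End round_up.

(** * Right-continuity along sequences *)

Section right_continuity.
Context {R : realType}.
Variable T : R.

(* Unlike in [x @ r^'+ --> x r], the sequence may take the value r. *)
Definition right_continuous_path (x : R -> R) := forall r (u : nat -> R),
  0 <= r -> (forall n, r <= u n <= T) -> u @ \oo --> r ->
  x (u n) @[n --> \oo] --> x r.

Lemma cadlag_path_right_continuous x :
  cadlag_path T x -> right_continuous_path x.
Proof.
move=> [rc _] r u r0 ru ur.
have /andP[r_u u_T] := ru 0%N; have := le_trans r_u u_T.
rewrite le_eqVlt => /predU1P[rT|rT].
  (* At r = T [cadlag_path] gives no limit from the right, but the sequence is confined to
     [T, T]. *)
  have -> : u = cst T.
    by apply/funext => n; apply/eqP; rewrite eq_le -{2}rT andbC; exact: ru.
  by rewrite rT; exact: (@cvg_cst _ (x T)).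
have {rc} : x @ r^'+ --> x r by apply: rc; rewrite r0.
move=> /cvgrPdist_lt rc; apply/cvgrPdist_lt => e e0.
have [d /= d0 rd] := rc _ e0.
move/cvgrPdist_lt : ur => /(_ d d0); apply: filterS => n rn.
have /andP[] := ru n; rewrite le_eqVlt => /predU1P[<- _|? _].
  by rewrite subrr normr0.
exact: rd.
Qed.

(** The indicator depends on [w] alone, and min(., tau w) is nondecreasing and 1-Lipschitz: it turns
    a sequence tending to r from the right into one tending to min(r, tau w) from the right. *)
Lemma stopped_right_continuous d (Omega : measurableType d) (tau : Omega -> R)
    (X : R -> Omega -> R) w : 0 <= tau w <= T ->
  right_continuous_path (X ^~ w) -> right_continuous_path (stopped tau X ^~ w).
Proof.
move=> /andP[tau0 tauT] rc r u r0 ru ur; rewrite /stopped.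
case: ifP => _; last exact: cvg_cst.
apply: (rc _ (fun n => Num.min (u n) (tau w))).
- by rewrite le_min r0.
- move=> n; have /andP[ru_ uT] := ru n.
  by rewrite le_min2//= ge_min uT.
- move/cvgrPdist_lt : ur => ur; apply/cvgrPdist_lt => e e0.
  have := ur _ e0; apply: filterS => n; apply: le_lt_trans.
  have /andP[ru_ _] := ru n; rewrite distrC [leRHS]distrC !ger0_norm ?subr_ge0 ?le_min2//.
  by rewrite !minElt; case: (ltP r (tau w)); case: (ltP (u n) (tau w)) => *; lra.
Qed.

End right_continuity.

(** * Measurability with respect to a sub-sigma-algebra *)

Section sub_sigma_algebra.
Context {R : realType} {d : measure_display} {Omega : measurableType d}.
Variable G : set_system Omega.
Hypothesis sG : sigma_algebra setT G.

Lemma measurable_g_sigma_algebraType : G.-sigma.-measurable = G.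
Proof. exact: sigma_algebra_id sG. Qed.

Lemma sub_sigma_algebraC E : G E -> G (~` E).
Proof. by rewrite -setTD; case: sG => _ + _; apply. Qed.

Lemma sub_sigma_algebraI E E' : G E -> G E' -> G (E `&` E').
Proof. by rewrite -measurable_g_sigma_algebraType; exact: measurableI. Qed.

Lemma sub_sigma_algebraU E E' : G E -> G E' -> G (E `|` E').
Proof. by rewrite -measurable_g_sigma_algebraType; exact: measurableU. Qed.

Lemma sub_sigma_algebra_bigsetU (I : Type) (r : seq I) (E : I -> set Omega) :
  (forall i, G (E i)) -> G (\big[setU/set0]_(i <- r) E i).
Proof.
move=> GE; elim/big_ind : _ => //; first by case: sG.
exact: sub_sigma_algebraU.
Qed.

Lemma sub_measurable_funP (Y : Omega -> R) :
  sub_measurable_fun G Y <->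
  measurable_fun [set: g_sigma_algebraType G] (Y : g_sigma_algebraType G -> R).
Proof.
split=> [GY _ B mB|mY B mB].
  by rewrite setTI measurable_g_sigma_algebraType; exact: GY.
rewrite -measurable_g_sigma_algebraType -[_ @^-1` _]setTI.
exact: mY.
Qed.


(** The convergence set D is in G, its complement being negligible. On D the limit is a pointwise
    one; off D every preimage is negligible, hence in G. *)
Lemma sub_measurable_fun_ae_cvg (P : probability Omega R)
    (Y_ : nat -> Omega -> R) (Y : Omega -> R) :
  P.-negligible `<=` G -> (forall n, sub_measurable_fun G (Y_ n)) ->
  {ae P, forall w, Y_ n w @[n --> \oo] --> Y w} -> sub_measurable_fun G Y.
Proof.
move=> nG GY_ YY B mB; pose D := [set w | Y_ n w @[n --> \oo] --> Y w].
have GD : G D by rewrite -[D]setCK; apply: sub_sigma_algebraC; exact: nG.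
have -> : Y @^-1` B = (D `&` Y @^-1` B) `|` (~` D `&` Y @^-1` B).
  by rewrite -setIUl setUv setTI.
apply: sub_sigma_algebraU; last first.
  by apply: nG; apply: negligibleS YY => w [].
have mD : G.-sigma.-measurable D by rewrite measurable_g_sigma_algebraType.
rewrite -measurable_g_sigma_algebraType.
apply: (@measurable_fun_cvg _ (g_sigma_algebraType G) R D
    Y_ Y) => // n.
apply: measurable_funS (iffLR (sub_measurable_funP _) (GY_ n)) => //.
Qed.

End sub_sigma_algebra.

(** * Stopping times and sampling along a grid *)

Section stopping.
Context {R : realType} {d : measure_display} {Omega : measurableType d}.
Variables (T : R) (F : R -> set_system Omega).
Hypothesis hF : filtration T F.
Implicit Types (tau : Omega -> R) (X : R -> Omega -> R).

Lemma sub_measurable_fun_measurable t (Y : Omega -> R) : 0 <= t <= T ->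
  sub_measurable_fun (F t) Y -> measurable_fun setT Y.
Proof.
by move=> tT mY _ B mB; rewrite setTI; apply: (filtration_measurable hF tT); exact: mY.
Qed.

Lemma stopping_time_gt tau s : stopping_time T F tau -> 0 <= s <= T ->
  F s [set w | s < tau w].
Proof.
move=> [_ mtau] sT.
rewrite (_ : mkset _ = ~` [set w | tau w <= s]); last first.
  by apply/seteqP; split=> w /=; rewrite ltNge => /negP.
by apply: sub_sigma_algebraC; [exact: (filtration_sigma_algebra hF)|exact: mtau].
Qed.

Lemma stopping_time_itv tau a b : stopping_time T F tau ->
  0 <= a -> a <= b -> b <= T -> F b [set w | a < tau w <= b].
Proof.
move=> stau a0 ab bT; have b0 := le_trans a0 ab.
rewrite (_ : mkset _ = [set w | a < tau w] `&` [set w | tau w <= b]); last first.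
  by apply/seteqP; split=> w; move/andP.
apply: sub_sigma_algebraI.
- by apply: (filtration_sigma_algebra hF); rewrite b0.
- apply: (filtration_mono hF a0 ab bT); apply: stopping_time_gt => //.
  by rewrite a0 (le_trans ab).
- by case: stau => _; apply; rewrite b0.
Qed.

Lemma stopping_time_min tau t : stopping_time T F tau -> 0 <= t <= T ->
  stopping_time T F (fun w => Num.min t (tau w)).
Proof.
move=> [tauT mtau] /andP[t0 tT]; split=> [w|r rT].
  by have /andP[? ?] := tauT w; rewrite le_min t0 ge_min tT; apply/andP.
have [sF0 sFD _] := filtration_sigma_algebra hF rT.
have [tr|rt] := leP t r.
  rewrite (_ : mkset _ = setT `\` set0); first exact: sFD.
  by rewrite setD0; apply/seteqP; split=> w //= _; rewrite ge_min tr.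
rewrite (_ : mkset _ = [set w | tau w <= r]); first exact: mtau.
by apply/seteqP; split=> w /=; rewrite ge_min leNgt rt.
Qed.

(** The default 0 agrees with that of [stopped] when s = 0; in the integrals below, only events
    inside {s < tau} occur. *)
Definition discretized s t k tau X : Omega -> R :=
  fun w => if s < tau w then X (round_up s t k (tau w)) w else 0.

(** The rounded time is constant on each cell, so the event splits into finitely many events about X
    at deterministic times. *)
Lemma discretized_preimage s t k tau X (B : set R) : s < t ->
    (forall w, tau w <= t) ->
  [set w | s < tau w] `&` discretized s t k tau X @^-1` B =
  \big[setU/set0]_(i < k.+1)
    ([set w | grid s t k i < tau w <= grid s t k i.+1] `&`
     X (grid s t k i.+1) @^-1` B).
Proof.
move=> st taut; rewrite -bigcup_mkord_ord; apply/seteqP; split=> w.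
- move=> [/= sw XB]; have [i ik iw] : exists2 i, (i < k.+1)%N &
      grid s t k i < tau w <= grid s t k i.+1.
    by apply: grid_cell; rewrite sw taut.
  exists i => //=.
  by move: XB; rewrite /discretized sw (round_up_cell st iw) inordK.
- move=> [i /= ik]; rewrite inordK// => -[iw XB].
  have sw : s < tau w.
    case/andP: iw => + _; apply: le_lt_trans.
    by case/andP: (grid_itv st (ltnW ik)).
  by split=> //=; rewrite /discretized sw (round_up_cell st iw).
Qed.

(** This is why times are rounded up: at the right end of a cell it is already known whether tau
    fell in that cell. *)
Lemma discretized_cell_measurable s t k i tau X (B : set R) :
  stopping_time T F tau -> adapted T F X -> measurable B ->
  0 <= s -> s < t -> t <= T -> (i < k.+1)%N ->
  F (grid s t k i.+1) ([set w | grid s t k i < tau w <= grid s t k i.+1] `&`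
     X (grid s t k i.+1) @^-1` B).
Proof.
move=> stau aX mB s0 st tT ik.
have /andP[si it] := grid_itv st (ltnW ik).
have /andP[si1 i1t] := grid_itv st ik.
have i1T : 0 <= grid s t k i.+1 <= T.
  by rewrite (le_trans s0 si1) (le_trans i1t tT).
apply: sub_sigma_algebraI; first exact: (filtration_sigma_algebra hF).
- apply: stopping_time_itv => //; first exact: le_trans si.
    by rewrite ltW// grid_mono.
  by case/andP: i1T.
- exact: aX.
Qed.

Lemma discretized_measurable s t k tau X : stopping_time T F tau ->
  adapted T F X -> 0 <= s -> s < t -> t <= T -> (forall w, tau w <= t) ->
  sub_measurable_fun (F t) (discretized s t k tau X).
Proof.
move=> stau aX s0 st tT taut B mB.
have t0T : 0 <= t <= T by rewrite tT andbT (le_trans s0)// ltW.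
have sFt := filtration_sigma_algebra hF t0T.
have s0T : 0 <= s <= T by rewrite s0 (le_trans (ltW st)).
have Fts : F t [set w | s < tau w].
  by apply: (filtration_mono hF s0 (ltW st) tT); exact: stopping_time_gt.
rewrite (_ : _ @^-1` _ =
  ([set w | s < tau w] `&` discretized s t k tau X @^-1` B) `|`
  (~` [set w | s < tau w] `&` cst 0 @^-1` B)); last first.
  apply/seteqP; split=> w /=; rewrite /discretized.
    by case: ifP => [? ?|/negP ? ?]; [left|right].
  by case: ifP => [? [[]//|[]//]|? [[]//|[]//]].
apply: sub_sigma_algebraU => //; last first.
  apply: sub_sigma_algebraI => //; first exact: sub_sigma_algebraC.
  rewrite preimage_cst; have [F0 FC _] := sFt.
  by case: ifP => _ //; rewrite -[setT]setD0; exact: FC.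
rewrite discretized_preimage//; apply: sub_sigma_algebra_bigsetU => // i.
have /andP[si it] := grid_itv st (ltn_ord i).
apply: (filtration_mono hF _ it tT); first exact: le_trans si.
exact: discretized_cell_measurable.
Qed.

Lemma cvg_discretized s t tau X w : 0 <= s -> s < t -> t <= T ->
  right_continuous_path T (X ^~ w) -> s < tau w <= t ->
  discretized s t k tau X w @[k --> \oo] --> X (tau w) w.
Proof.
move=> s0 st tT rc stau; have /andP[sw _] := stau; rewrite /discretized sw.
apply: rc.
- exact/ltW/(le_lt_trans s0).
- by move=> k; have /andP[-> /=] := round_up_itv k stau => /le_trans; apply.
- exact: cvg_round_up.
Qed.

(** For t > 0, the variable is the almost sure limit of the discretizations of min(t, tau) on ]0,
    t], each measurable for [F t]; the null sets in [F 0] absorb the exceptional set. For t = 0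
    there is no grid, and the variable is X 0 on {0 < tau} and 0 elsewhere. *)
Lemma stopped_adapted (P : probability Omega R) tau X :
  P.-negligible `<=` F 0 -> stopping_time T F tau -> adapted T F X ->
  {ae P, forall w, right_continuous_path T (X ^~ w)} ->
  adapted T F (stopped tau X).
Proof.
move=> nF stau aX rcX t /andP[]; rewrite le_eqVlt => /predU1P[<-{t} T0|t0 tT].
  have T00 : 0 <= (0 : R) <= T by rewrite lexx.
  have sF0 := filtration_sigma_algebra hF T00.
  have tau0 := stopping_time_gt stau T00.
  move=> B mB; rewrite (_ : _ @^-1` _ =
      ([set w | 0 < tau w] `&` X 0 @^-1` B) `|`
      (~` [set w | 0 < tau w] `&` cst 0 @^-1` B)); last first.
    apply/seteqP; split=> w /=; rewrite /stopped; case: ifP => [tw|/negP tw];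
      rewrite ?(min_idPl (ltW tw)); [by left|by right| |].
    - by case=> -[].
    - by case=> -[].
  apply: sub_sigma_algebraU => //; apply: sub_sigma_algebraI => //.
  - exact: aX.
  - exact: sub_sigma_algebraC.
  - rewrite preimage_cst; have [F0 FC _] := sF0.
    by case: ifP => _ //; rewrite -[setT]setD0; exact: FC.
have t0T : 0 <= t <= T by rewrite (ltW t0).
pose tau' w := Num.min t (tau w).
have stau' : stopping_time T F tau' by exact: stopping_time_min.
have tau't w : tau' w <= t by rewrite /tau' ge_min lexx.
apply: (@sub_measurable_fun_ae_cvg _ _ _ _ (filtration_sigma_algebra hF t0T) P
  (fun k => discretized 0 t k tau' X)).
- by move=> N /nF; exact: (filtration_mono hF (lexx _) (ltW t0) tT).
- by move=> k; exact: discretized_measurable.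
- apply: filterS rcX => w rcw; rewrite /stopped.
  have -> : (0 < tau w) = (0 < tau' w) by rewrite /tau' lt_min t0.
  case: ifPn => tw; last by rewrite /discretized (negPf tw); exact: cvg_cst.
  by apply: cvg_discretized => //; rewrite tw tau't.
Qed.

End stopping.

(** * Integrals of almost surely bounded variables *)

Section bounded_integrals.
Context {R : realType} {d : measure_display} {Omega : measurableType d}.
Variable Q : probability Omega R.
Implicit Type E : set Omega.

Lemma ae_bounded_integrable E (Y : Omega -> R) C : measurable E ->
  measurable_fun setT Y -> {ae Q, forall w, E w -> `|Y w| <= C} ->
  Q.-integrable E (EFin \o Y).
Proof.
move=> mE mY YC.
have mYE : measurable_fun E (EFin \o Y).
  by apply: (measurable_funS measurableT) => //; exact/measurable_EFinP.
(* Dominated convergence for a constant sequence: among its conclusions is the integrability of the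
   limit. *)
case: (@dominated_convergence _ _ _ Q E mE (fun=> EFin \o Y) (EFin \o Y)
  (EFin \o cst C) (fun=> mYE) mYE _ _ _) => //.
- by apply: aeW => w _; exact: cvg_cst.
- exact: finite_measure_integrable_cst.
- by apply: filterS YC => w YC _ Ew /=; rewrite lee_fin; exact: YC.
Qed.

Lemma ae_bounded_cvg_integral E (Y_ : nat -> Omega -> R) (Y : Omega -> R) C :
  measurable E -> (forall n, measurable_fun setT (Y_ n)) ->
  measurable_fun setT Y ->
  {ae Q, forall w, E w -> Y_ n w @[n --> \oo] --> Y w} ->
  {ae Q, forall w, forall n, E w -> `|Y_ n w| <= C} ->
  (\int[Q]_(w in E) (Y_ n w)%:E @[n --> \oo] --> \int[Q]_(w in E) (Y w)%:E)%E.
Proof.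
move=> mE mY_ mY YY YC.
have mEFin (Z : Omega -> R) : measurable_fun setT Z -> measurable_fun E (EFin \o Z).
  move=> mZ; apply: (measurable_funS measurableT) => //; exact/measurable_EFinP.
case: (@dominated_convergence _ _ _ Q E mE (fun n => EFin \o Y_ n) (EFin \o Y)
  (EFin \o cst C) (fun n => mEFin _ (mY_ n)) (mEFin _ mY) _ _ _) => //.
- by apply: filterS YY => w YY Ew; apply: cvg_EFin; [exact: nearW|exact: YY].
- exact: finite_measure_integrable_cst.
Qed.

End bounded_integrals.

(** * Optional stopping when the stopped process is bounded *)

Section optional_stopping.
Context {R : realType} {d : measure_display} {Omega : measurableType d}.
Variables (Q : probability Omega R) (T : R) (F : R -> set_system Omega).
Hypothesis hF : filtration T F.
Implicit Types (tau : Omega -> R) (M : R -> Omega -> R) (E : set Omega).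

(** The domain is a disjoint union of cells. On each one the integrand is M at the right end of the
    cell, and the cell is an event of that time, so the martingale property moves the integrand to
    time t. The set [B] is there for a later truncation of the values. *)
Lemma discretized_integral s t k tau M E B :
  stopping_time T F tau -> martingale Q T F M -> measurable B ->
  0 <= s -> s < t -> t <= T -> (forall w, tau w <= t) ->
  F s E -> E `<=` [set w | s < tau w] ->
  (\int[Q]_(w in E `&` discretized s t k tau M @^-1` B)
      (discretized s t k tau M w)%:E =
   \int[Q]_(w in E `&` discretized s t k tau M @^-1` B) (M t w)%:E)%E.
Proof.
move=> stau [aM iM mM] mB s0 st tT taut FE Etau.
pose cell (i : 'I_k.+1) := E `&`
  ([set w | grid s t k i < tau w <= grid s t k i.+1] `&`
   M (grid s t k i.+1) @^-1` B).
have gsi (i : 'I_k.+1) : s <= grid s t k i.+1 by have /andP[] := grid_itv st (ltn_ord i).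
have git (i : 'I_k.+1) : grid s t k i.+1 <= t.
  by have /andP[] := grid_itv st (ltn_ord i).
have giT (i : 'I_k.+1) : 0 <= grid s t k i.+1 <= T.
  by rewrite (le_trans s0 (gsi i)) (le_trans (git i)).
have Fcell (i : 'I_k.+1) : F (grid s t k i.+1) (cell i).
  apply: sub_sigma_algebraI; first exact: (filtration_sigma_algebra hF).
    by apply: (filtration_mono hF s0 (gsi i)) => //; case/andP: (giT i).
  exact: (discretized_cell_measurable hF).
have mcell i : measurable (cell i) by exact: (filtration_measurable hF (giT i)).
have tcell : trivIset [set` index_enum 'I_k.+1] cell.
  move=> i j _ _ [w [[_ [iw _]] [_ [jw _]]]].
  by apply/val_inj; exact: grid_inj_cell iw jw.
have -> : E `&` discretized s t k tau M @^-1` B = \big[setU/set0]_(i < k.+1) cell i.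
  rewrite -(setIidl Etau) -setIA discretized_preimage// big_distrr/=.
  by apply: eq_bigr.
have Mt : measurable_fun setT (M t).
  have tT' : 0 <= t <= T by rewrite tT (le_trans s0)// ltW.
  by apply: (sub_measurable_fun_measurable hF tT'); exact: aM.
have tT' : 0 <= t <= T by rewrite tT (le_trans s0)// ltW.
rewrite integral_bigsetU_EFin//; first last.
- apply: (measurable_funS measurableT) => //; apply/measurable_EFinP.
  apply: (sub_measurable_fun_measurable hF tT').
  exact: (discretized_measurable hF).
- exact: index_enum_uniq.
rewrite integral_bigsetU_EFin//; first last.
- by apply: (measurable_funS measurableT) => //; exact/measurable_EFinP.
- exact: index_enum_uniq.
apply: eq_bigr => i _.
have [_ _ <-//] := mM (grid s t k i.+1) t (le_trans s0 (gsi i)) (git i) tT.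
apply: eq_integral => w; rewrite inE => -[_ [iw _]].
have sw : s < tau w.
  case/andP: iw => + _; apply: le_lt_trans.
  by case/andP: (grid_itv st (ltnW (ltn_ord i))).
by rewrite /discretized sw (round_up_cell st iw).
Qed.

Hypothesis Fcomplete : Q.-negligible `<=` F 0.

(* [M t] dominates the discretized values only through conditional expectations,
   and M is bounded before tau but not just after it, so uniform integrability
   would be needed.  Instead both sides of [discretized_integral] are restricted
   to the event that the discretized value lies in [- c, c] with [c > C], an event
   whose indicator tends to 1 because the limit is bounded by C. *)
Lemma optional_stopping_after s t tau M E C :
  stopping_time T F tau -> martingale Q T F M ->
  {ae Q, forall w, right_continuous_path T (M ^~ w)} ->
  0 <= s -> s <= t -> t <= T -> F s E -> E `<=` [set w | s < tau w] ->
  {ae Q, forall w, `|stopped tau M t w| <= C} ->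
  (\int[Q]_(w in E) (stopped tau M t w)%:E = \int[Q]_(w in E) (M s w)%:E)%E.
Proof.
move=> stau mtgM rcM s0; rewrite le_eqVlt => /predU1P[<-{t} sT FE Etau _|].
  apply: eq_integral => w; rewrite inE => /Etau /= stw.
  by rewrite /stopped (le_lt_trans s0 stw) (min_idPl (ltW stw)).
move=> st tT FE Etau boundM.
have [aM iM mM] := mtgM.
have t0 : 0 < t := le_lt_trans s0 st.
have t0T : 0 <= t <= T by rewrite ltW.
have s0T : 0 <= s <= T by rewrite s0 (le_trans (ltW st)).
have mE : measurable E by apply: (filtration_measurable hF s0T).
pose tau' w := Num.min t (tau w).
have stau' : stopping_time T F tau' by exact: (stopping_time_min hF).
have tau't w : tau' w <= t by rewrite /tau' ge_min lexx.
have Etau' : E `<=` [set w | s < tau' w].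
  by move=> w /Etau /= stw; rewrite /tau' lt_min st.
pose Y k := discretized s t k tau' M.
(* The margin 1 is the distance to the limit within which the discretized values eventually stay, in
   [evA]. *)
pose c := C + 1.
pose B : set R := [set` `[- c, c]].
have mB : measurable B by exact: measurable_itv.
pose A k := Y k @^-1` B.
have mY k : measurable_fun setT (Y k).
  apply: (sub_measurable_fun_measurable hF t0T).
  exact: (discretized_measurable hF).
have mA k : measurable (A k) by rewrite -[A k]setTI; exact: mY.
have mstop : measurable_fun setT (stopped tau M t).
  apply: (sub_measurable_fun_measurable hF t0T).
  exact: (stopped_adapted hF Fcomplete).
have mMt : measurable_fun setT (M t).
  by apply: (sub_measurable_fun_measurable hF t0T); exact: aM.
have cvgY : {ae Q, forall w, E w -> Y k w @[k --> \oo] --> stopped tau M t w}.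
  apply: filterS rcM => w rcw Ew.
  have -> : stopped tau M t w = M (tau' w) w.
    by rewrite /stopped (le_lt_trans s0 (Etau _ Ew)).
  apply: (cvg_discretized s0 st tT rcw).
  by rewrite (Etau' _ Ew) tau't.
have evA : {ae Q, forall w, E w -> \forall k \near \oo, A k w}.
  apply: filterS2 cvgY boundM => w cvgw boundw Ew.
  have /cvgrPdist_lt/(_ 1 ltr01) := cvgw Ew.
  apply: filterS => k; rewrite /A /B /= in_itv /= -ler_norml distrC => Ykw.
  rewrite /c -[Y k w](subrK (stopped tau M t w)) [leRHS]addrC.
  by rewrite (le_trans (ler_normD _ _))// lerD// ltW.
have cvgl : (\int[Q]_(w in E `&` A k) (Y k w)%:E @[k --> \oo] -->
    \int[Q]_(w in E) (stopped tau M t w)%:E)%E.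
  (* The varying domain is traded for a restricted integrand on the fixed domain E, as dominated
     convergence requires. *)
  rewrite (_ : (fun k => _) =
      (fun k => \int[Q]_(w in E) ((Y k \_ (A k)) w)%:E)%E); last first.
    apply/funext => k; rewrite integral_mkcondr; apply: eq_integral => w _.
    by rewrite restrict_EFin.
  apply: (@ae_bounded_cvg_integral _ _ _ _ _ _ _ c) => //.
  - by move=> k; apply/(measurable_restrictT _ (mA k)); exact: (measurable_funS measurableT).
  - apply: filterS2 cvgY evA => w cvgw evw Ew.
    apply: cvg_trans (cvgw Ew); apply: near_eq_cvg.
    by apply: filterS (evw Ew) => k Akw; rewrite patchT// inE.
  - apply: filterS boundM => w boundw k Ew; rewrite /patch.
    case: ifPn => [|_]; first by rewrite inE /A /B /= in_itv /= -ler_norml.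
    (* Outside [A k] the integrand is 0, and c is nonnegative because C bounds an absolute value at
       [w]. *)
    by rewrite normr0 /c (le_trans (normr_ge0 _) (le_trans boundw _))// lerDl.
have cvgr : (\int[Q]_(w in E `&` A k) (M t w)%:E @[k --> \oo] -->
    \int[Q]_(w in E) (M t w)%:E)%E.
  rewrite (_ : (fun k => _) =
      (fun k => \int[Q]_(w in E) ((M t \_ (A k)) w)%:E)%E); last first.
    apply/funext => k; rewrite integral_mkcondr; apply: eq_integral => w _.
    by rewrite restrict_EFin.
  have mEFin (Z : Omega -> R) : measurable_fun setT Z -> measurable_fun E (EFin \o Z).
    move=> mZ; apply: (measurable_funS measurableT) => //; exact/measurable_EFinP.
  case: (@dominated_convergence _ _ _ Q E mE (fun k => EFin \o (M t \_ (A k)))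
    (EFin \o M t) (abse \o (EFin \o M t)) _ (mEFin _ mMt) _ _ _) => //.
  - move=> k; apply: mEFin; apply/(measurable_restrictT _ (mA k)).
    exact: (measurable_funS measurableT).
  - apply: filterS evA => w evw Ew.
    apply: cvg_near_cst.
    by apply: filterS (evw Ew) => k Akw /=; rewrite patchT// inE.
  - apply: integrable_abse; apply: (integrableS measurableT) => //.
    exact: iM.
  - apply: aeW => w k Ew /=; rewrite lee_fin /patch.
    by case: ifPn => // _; rewrite normr0.
(* As E is in [F s], the right-hand side becomes the integral of [M t]. Both sides are then limits
   of sequences that agree term by term. *)
have [_ _ ->//] := mM s t s0 (ltW st) tT.
apply: (cvg_unique _ cvgl) => //; apply: cvg_trans cvgr.
apply: near_eq_cvg; apply: nearW => k; apply/esym.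
exact: discretized_integral.
Qed.

(** An event E of [F s] is cut along {s < tau}. Where tau <= s, the stopped path no longer moves
    after s. Where s < tau, [optional_stopping_after], used once up to t and once with s in place of
    t, reduces both integrals to that of [M s]. *)
Lemma stopped_martingale tau M C : stopping_time T F tau ->
  martingale Q T F M ->
  {ae Q, forall w, right_continuous_path T (M ^~ w)} ->
  {ae Q, forall w, forall t : R, 0 <= t <= T -> `|stopped tau M t w| <= C} ->
  martingale Q T F (stopped tau M).
Proof.
move=> stau mtgM rcM boundM; have [aM _ _] := mtgM.
have aMtau := stopped_adapted hF Fcomplete stau aM rcM.
have mMtau t (tT : 0 <= t <= T) : measurable_fun setT (stopped tau M t).
  by apply: (sub_measurable_fun_measurable hF tT); exact: aMtau.
have bMtau t : 0 <= t <= T -> {ae Q, forall w, `|stopped tau M t w| <= C}.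
  by move=> tT; apply: filterS boundM => w; apply.
have iMtau t : 0 <= t <= T -> Q.-integrable setT (EFin \o stopped tau M t).
  move=> tT; apply: (@ae_bounded_integrable _ _ _ _ _ _ C) => //.
    exact: mMtau.
  by apply: filterS (bMtau t tT).
split=> // s t s0 st tT.
have sT : 0 <= s <= T by rewrite s0 (le_trans st).
have t0T : 0 <= t <= T by rewrite tT (le_trans s0).
split; [exact: aMtau|exact: iMtau|move=> E FE].
pose D := [set w | s < tau w].
have FD : F s D by exact: (stopping_time_gt hF).
have sFs := filtration_sigma_algebra hF sT.
have FED : F s (E `&` D) by exact: sub_sigma_algebraI.
have FEC : F s (E `&` ~` D).
  by apply: sub_sigma_algebraI => //; exact: sub_sigma_algebraC.
have mF E' : F s E' -> measurable E' by apply: (filtration_measurable hF sT).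
have -> : E = (E `&` D) `|` (E `&` ~` D) by rewrite -setIUr setUv setIT.
have dED : [disjoint (E `&` D) & (E `&` ~` D)].
  by apply/disj_setPS => w [[_ ?] [_]].
have mEDC r : 0 <= r <= T -> measurable_fun ((E `&` D) `|` (E `&` ~` D))
    (EFin \o stopped tau M r).
  move=> rT; apply: (measurable_funS measurableT) => //.
  by apply/measurable_EFinP; exact: mMtau.
rewrite (integral_setU _ (mF _ FED) (mF _ FEC) (mEDC _ sT) dED).
rewrite (integral_setU _ (mF _ FED) (mF _ FEC) (mEDC _ t0T) dED).
congr (_ + _)%E.
- have EDs : E `&` D `<=` [set w | s < tau w] by move=> w [].
  rewrite (optional_stopping_after stau mtgM rcM s0 st tT FED EDs (bMtau t t0T)).
  by rewrite (optional_stopping_after stau mtgM rcM s0 _ _ FED EDs (bMtau s sT))//;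
    case/andP: sT.
- apply: eq_integral => w /set_mem[_ /negP]; rewrite -leNgt => tws.
  rewrite /stopped /=; case: (0 < tau w) => //.
  by rewrite (min_idPr tws) (min_idPr (le_trans tws st)).
Qed.

End optional_stopping.

(** * Stopping a local martingale at a time up to which it is bounded *)

Lemma stopped_local_martingale (R : realType) (d : measure_display)
    (Omega : measurableType d) (Q : probability Omega R) (T : R)
    (F : R -> set_system Omega) (tau : Omega -> R) (X : R -> Omega -> R)
    (C : R) :
  0 < T -> filtration T F -> Q.-negligible `<=` F 0 ->
  stopping_time T F tau -> local_martingale Q T F X ->
  {ae Q, forall w, forall t : R, 0 <= t <= T -> `|stopped tau X t w| <= C} ->
  martingale Q T F (stopped tau X).
Proof.
move=> T0 hF nF stau [aX cX [sigma [ssigma sigma_nd sigmaT] mX]] boundX.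
have rcX : {ae Q, forall w, right_continuous_path T (X ^~ w)}.
  by apply: filterS cX => w; exact: cadlag_path_right_continuous.
pose N m := stopped tau (stopped (sigma m) X).
(* [|C|] is nonnegative by construction, which settles the paths where an indicator makes [N m]
   vanish. *)
have boundN m : {ae Q, forall w, forall t : R, 0 <= t <= T -> `|N m t w| <= `|C|}.
  apply: filterS boundX => w Xw t /andP[t0 tT].
  have [[sw _] [tw _]] := (ssigma m, stau).
  rewrite /N /stopped; case: ifPn => [tau0|_]; last by rewrite normr0.
  case: ifPn => [sigma0|_]; last by rewrite normr0.
  have mT : 0 <= Num.min t (sigma m w) <= T.
    by rewrite le_min t0 ltW//= ge_min tT.
  (* The value of [N m] at t is that of [stopped tau X] at time min(t, sigma m), which makes the
     bound uniform in m. *)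
  have := Xw _ mT; rewrite /stopped tau0 minAC => /le_trans; apply.
  exact: ler_norm.
have mN m : martingale Q T F (N m).
  apply: (stopped_martingale hF nF stau (mX m) _ (boundN m)).
  apply: filterS rcX => w rcw; apply: stopped_right_continuous => //.
  by case: (ssigma m).
have cvgN : {ae Q, forall w, forall t : R, 0 <= t <= T ->
    N m t w @[m --> \oo] --> stopped tau X t w}.
  apply: filterS sigmaT => w [n sn] t /andP[t0 tT].
  (* The sequence is eventually constant: once sigma reaches T it stays there, and 0 < T makes its
     indicator equal to 1. *)
  apply: cvg_near_cst; exists n => // m /= nm.
  have sm : sigma m w = T.
    apply/eqP; rewrite eq_le -{2}sn (sigma_nd w _ _ nm) andbT.
    by have [/(_ w)/andP[_ ->]] := ssigma m.
  by rewrite /N /stopped sm T0 (min_idPl (_ : Num.min t (tau w) <= T))// ge_min tT.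
have aXtau : adapted T F (stopped tau X) by exact: (stopped_adapted hF nF stau aX rcX).
have mXtau t (tT : 0 <= t <= T) : measurable_fun setT (stopped tau X t).
  by apply: (sub_measurable_fun_measurable hF tT); exact: aXtau.
have iXtau t : 0 <= t <= T -> Q.-integrable setT (EFin \o stopped tau X t).
  move=> tT; apply: (@ae_bounded_integrable _ _ _ _ _ _ C) => //.
    exact: mXtau.
  by apply: filterS boundX => w Xw _; exact: Xw.
split=> // s t s0 st tT.
have sT : 0 <= s <= T by rewrite s0 (le_trans st).
have t0T : 0 <= t <= T by rewrite tT (le_trans s0).
split; [exact: aXtau|exact: iXtau|move=> E FE].
have mE : measurable E by apply: (filtration_measurable hF sT).
have cvgE r : 0 <= r <= T -> (\int[Q]_(w in E) (N m r w)%:E @[m --> \oo] -->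
    \int[Q]_(w in E) (stopped tau X r w)%:E)%E.
  move=> rT; apply: (@ae_bounded_cvg_integral _ _ _ _ _ _ _ `|C|) => //.
  - move=> m; apply: (sub_measurable_fun_measurable hF rT).
    by have [aN _ _] := mN m; exact: aN.
  - exact: mXtau.
  - by apply: filterS cvgN => w Nw _; exact: Nw.
  - by apply: filterS (ae_foralln boundN) => w Nw m _; exact: Nw.
apply: (cvg_unique _ (cvgE s sT)) => //; apply: cvg_trans (cvgE t t0T).
apply: near_eq_cvg; apply: nearW => m.
by have [_ _ /(_ s t s0 st tT)[_ _ ->]] := mN m.
Qed.

(** * Change of measure, the natural filtration, and the conclusion *)

Lemma negligible_dominates (R : realType) (d : measure_display)
    (Omega : measurableType d) (P Q : probability Omega R) :
  Q `<< P -> P.-negligible `<=` Q.-negligible.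
Proof.
move=> /null_content_dominatesP QP N [B [mB PB NB]].
by exists B; split => //; exact: QP.
Qed.

Lemma natural_filtration_sigma_algebra (R : realType) (d : measure_display)
    (Omega : measurableType d) (P : probability Omega R) (T : R)
    (A : finType) (S : A -> R -> Omega -> R) (t : R) :
  sigma_algebra setT (natural_filtration P T S t).
Proof. by apply: sigma_algebra_bigcap => u _; exact: smallest_sigma_algebra. Qed.

Lemma natural_filtration_mono (R : realType) (d : measure_display)
    (Omega : measurableType d) (P : probability Omega R) (T : R)
    (A : finType) (S : A -> R -> Omega -> R) (s t : R) : s <= t ->
  natural_filtration P T S s `<=` natural_filtration P T S t.
Proof. by move=> st E FE u /= tu; apply: FE => /=; exact: le_lt_trans tu. Qed.

Lemma natural_filtration_negligible (R : realType) (d : measure_display)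
    (Omega : measurableType d) (P : probability Omega R) (T : R)
    (A : finType) (S : A -> R -> Omega -> R) (t : R) :
  P.-negligible `<=` natural_filtration P T S t.
Proof. by move=> N PN u _; apply: sub_sigma_algebra; right. Qed.

Theorem theorem3p1 (R : realType) (d : measure_display)
    (Omega : measurableType d) (P : probability Omega R) (T : R) (hT : 0 < T)
    (A : finType) (S : A -> R -> Omega -> R)
    (hS : forall i, semimartingale P T (natural_filtration P T S) (S i))
    (hSb : locally_bounded P T (natural_filtration P T S) S)
    (H : R -> set_system Omega)
    (hH : usual_conditions P T H)
    (hFH : sub_filtration T (natural_filtration P T S) H)
    (Q : probability Omega R) (hQP : equivalent_measures Q P)
    (hQH : forall i, local_martingale Q T H (S i)) :
  forall i, local_martingale Q T (natural_filtration P T S) (S i).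
Proof.
move=> i; have [QP PQ] := hQP.
have [hFiltH nH _] := hH.
have [aS cadS _] := hS i.
have [tau [stau tau_nd tauT] boundS] := hSb.
set F := natural_filtration P T S in hFH aS stau *.
have hF : filtration T F.
  split=> [t _|t tT E FE|s t _ st _].
  - exact: natural_filtration_sigma_algebra.
  (* Measurability of the events of F, null sets included, is inherited from H. *)
  - by apply: (filtration_measurable hFiltH tT); exact: hFH.
  - exact: natural_filtration_mono.
have nQH : Q.-negligible `<=` H 0 by move=> N /(negligible_dominates PQ)/nH.
(* An almost sure statement is the negligibility of its complement, so the inclusion of null sets
   carries it from P to Q. *)
have cadQ : cadlag Q T (S i) by exact: (negligible_dominates QP).
split=> //; exists tau.
  by split=> //; exact: (negligible_dominates QP).
move=> n; have [C boundC] := boundS n.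
have boundQ : {ae Q, forall w, forall t : R, 0 <= t <= T ->
    `|stopped (tau n) (S i) t w| <= C}.
  by apply: (negligible_dominates QP); apply: filterS boundC => w; apply.
have stauH : stopping_time T H (tau n).
  by have [tT mtau] := stau n; split=> // t t0T; apply: hFH => //; exact: mtau.
have [aH iH mH] :=
  stopped_local_martingale hT hFiltH nQH stauH (hQH i) boundQ.
have aF : adapted T F (stopped (tau n) (S i)).
  (* Adaptedness is obtained under P, whose null sets complete the natural filtration; only the
     martingale identity refers to Q. *)
  apply: (@stopped_adapted _ _ _ _ _ hF P) => //.
    exact: natural_filtration_negligible.
  by apply: filterS cadS => w; exact: cadlag_path_right_continuous.
split=> // s t s0 st tT.
have sT : 0 <= s <= T by rewrite s0 (le_trans st).
have [_ iHs eqH] := mH s t s0 st tT.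
by split=> [||E FE]; [exact: aF|exact: iHs|apply: eqH; exact: hFH].
Qed.
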